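(* Let $r\le m$ and assume that $C_j\in\mathbb{R}^{m\times\overline{w}}$ has full row-rank $m$. Let $$\mathcal{V}_r(m_s,m):=\{(\mathbf{a},\mathbf{b})\in\mathbb{R}^{m_s\times r}\times\mathbb{R}^{m\times r}:\ \mathrm{rank}(\mathbf{a})=\mathrm{rank}(\mathbf{b})=r\}.$$ Then the solution of the minimization problem $$\min_{(\mathbf{a},\mathbf{b})\in\mathcal{V}_r(m_s,m)}\|S_j^\top R_j+\mathbf{a}\mathbf{b}^\top C_j\|_F^2$$ is given by $\mathbf{a}=[a_1\,\ldots\,a_r]\in\mathbb{R}^{m_s\times r}$ and $\mathbf{b}=[b_1\,\ldots\,b_r]\in\mathbb{R}^{m\times r}$, where $b_1,\dots,b_r$ are the eigenvectors of the generalized eigenvalue problem $$C_j(S_j^\top R_j)^\top(S_j^\top R_j)C_j^\top v=\lambda\,C_jC_j^\top v$$ corresponding to the $r$ largest eigenvalues $\lambda_1\ge\dots\ge\lambda_r\ge0$, and $$a_i=-\frac{1}{\|C_j^\top b_i\|^2}\,S_j^\top R_jC_j^\top b_i,\qquad i=1,\dots,r.$$ Moreover, the solution $(\mathbf{a},\mathbf{b})\in\mathcal{V}_r(m_s,m)$ of the minimization problem satisfies $$\|S_j^\top R_j+\mathbf{a}\mathbf{b}^\top C_j\|_F^2=\|S_j^\top R_j\|_F^2-\sum_{i=1}^r\lambda_i.$$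
   Context: $\|\cdot\|_F$ is the Frobenius norm and $\|\cdot\|$ the Euclidean norm; $r\in\mathbb{N}$. The index $j$ is fixed (it labels an adaptation step). $F_j\in\mathbb{R}^{d\times\overline{w}}$ is a given snapshot matrix. $U_j\in\mathbb{R}^{d\times m}$ (DEIM basis, where DEIM stands for discrete empirical interpolation method) and $P_j\in\mathbb{R}^{d\times m}$ (interpolation matrix, whose columns are distinct unit vectors of $\mathbb{R}^d$) are such that $P_j^\top U_j$ is nonsingular. The DEIM coefficient matrix is $C_j:=(P_j^\top U_j)^{-1}P_j^\top F_j\in\mathbb{R}^{m\times\overline{w}}$, and the DEIM residual is $R_j:=U_jC_j-F_j\in\mathbb{R}^{d\times\overline{w}}$. The sampling matrix $S_j=[\mathbf{e}_{s_1^{(j)}}\,\ldots\,\mathbf{e}_{s_{m_s}^{(j)}}]\in\mathbb{R}^{d\times m_s}$ has as columns the unit vectors of $\mathbb{R}^d$ for distinct sampling indices $s_1^{(j)},\dots,s_{m_s}^{(j)}\in\{1,\dots,d\}$, where the number of sampling points is taken such that $m_s\ge m$ and $m_s\ll d$.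
   Formalization: (a,b) is claimed to be a solution only if one exists, shown equivalent to λ_1,…,λ_r>0 (if λ_r=0, a has rank below r and no minimum is attained); eigenvectors of a repeated eigenvalue are required to be CCᵀ-orthogonal, since otherwise the formula for a_i fails. *)

(* Defs.v *)
From mathcomp Require Import all_boot all_order all_algebra.
From mathcomp Require Import reals.

Set Implicit Arguments.
Unset Strict Implicit.
Unset Printing Implicit Defensive.

Import Order.TTheory GRing.Theory Num.Theory.
Local Open Scope ring_scope.

Definition frobenius (R : realType) (p q : nat) (A : 'M[R]_(p, q)) : R :=
  Num.sqrt (\sum_(i < p) \sum_(j < q) A i j ^+ 2).

Definition euclid (R : realType) (n : nat) (v : 'cV[R]_n) : R :=
  Num.sqrt (\sum_(i < n) v i 0 ^+ 2).

(* The columns are the unit vectors e_(s 0), ..., e_(s (k - 1)) of R^d. *)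
Definition unit_columns (R : realType) (d k : nat) (s : 'I_k -> 'I_d) :
  'M[R]_(d, k) := \matrix_(i, j) (i == s j)%:R.

Definition deim_coef (R : realType) (d w m : nat) (U P : 'M[R]_(d, m))
    (F : 'M[R]_(d, w)) : 'M[R]_(m, w) :=
  invmx (P^T *m U) *m (P^T *m F).

Definition deim_residual (R : realType) (d w m : nat) (U P : 'M[R]_(d, m))
    (F : 'M[R]_(d, w)) : 'M[R]_(d, w) :=
  U *m deim_coef U P F - F.

Definition gen_eigenvector (R : realType) (m : nat) (A B : 'M[R]_m)
    (lam : R) (v : 'cV[R]_m) : Prop :=
  v != 0 /\ A *m v = lam *: (B *m v).

(* lam enumerates, in nonincreasing order and with multiplicity, all the      *)
(* generalized eigenvalues of the pencil (A, B), i.e. the roots of            *)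
(* det (x B - A); meaningful when B is invertible.                            *)
Definition gen_eigenvalues (R : realType) (m : nat) (A B : 'M[R]_m)
    (lam : 'I_m -> R) : Prop :=
  \det ('X *: map_mx polyC B - map_mx polyC A)
    = \det B *: \prod_(i < m) ('X - (lam i)%:P)
  /\ (forall i j : 'I_m, (i <= j)%N -> lam j <= lam i).

(* The columns of b are eigenvectors for the r largest eigenvalues of the     *)
(* pencil (A, B). For symmetric A and positive definite B, eigenvectors of    *)
(* distinct eigenvalues are automatically B-orthogonal; those belonging to a  *)
(* repeated eigenvalue have to be chosen so.                                  *)
Definition top_eigenvectors (R : realType) (m r : nat) (hr : (r <= m)%N)
    (A B : 'M[R]_m) (lam : 'I_m -> R) (b : 'M[R]_(m, r)) : Prop :=
  [/\ gen_eigenvalues A B lam,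
      forall i : 'I_r, gen_eigenvector A B (lam (widen_ord hr i)) (col i b) &
      forall i j : 'I_r, i != j ->
        lam (widen_ord hr i) = lam (widen_ord hr j) ->
        (col i b)^T *m B *m col j b = 0].

Definition full_rank_pair (R : realType) (ms m r : nat)
    (x : 'M[R]_(ms, r) * 'M[R]_(m, r)) : Prop :=
  \rank x.1 = r /\ \rank x.2 = r.

(* Below, G stands for the sampled residual S^T R and C for the coefficients. *)

Definition objective (R : realType) (ms m w r : nat) (G : 'M[R]_(ms, w))
    (C : 'M[R]_(m, w)) (x : 'M[R]_(ms, r) * 'M[R]_(m, r)) : R :=
  frobenius (G + x.1 *m x.2^T *m C) ^+ 2.

Definition is_solution (R : realType) (ms m w r : nat) (G : 'M[R]_(ms, w))
    (C : 'M[R]_(m, w)) (x : 'M[R]_(ms, r) * 'M[R]_(m, r)) : Prop :=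
  full_rank_pair x /\
  forall y : 'M[R]_(ms, r) * 'M[R]_(m, r),
    full_rank_pair y -> objective G C x <= objective G C y.

Definition left_factor (R : realType) (ms m w r : nat) (G : 'M[R]_(ms, w))
    (C : 'M[R]_(m, w)) (b : 'M[R]_(m, r)) : 'M[R]_(ms, r) :=
  \matrix_(k, i)
    (- (1 / euclid (C^T *m col i b) ^+ 2) *: (G *m C^T *m col i b)) k 0.

(* Main.v *)
(* With D = C^T b, completing the square gives
     ||G + a D^T||^2 = ||G||^2 - tr((D^T D)^-1 D^T G^T G D)
                       + ||(a - a0) D^T||^2,   a0 = - G D (D^T D)^-1.
   Simultaneous diagonalization V^T B V = 1, V^T A V = diag lam and b = V c
   turn the middle trace into tr(Q diag lam), where Q is the orthogonal
   projector onto the range of c; its diagonal entries lie in [0, 1] and sum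
   to r, so the trace is at most lam_1 + ... + lam_r, with equality for top
   eigenvectors. Since a0 need not have rank r, the infimum over pairs of full
   rank is reached by perturbing a0. Hence any minimizer has a = a0, which
   forces rank (G C^T) >= r, that is, lam_r > 0. *)
Require Import Defs.
From mathcomp Require Import all_boot all_order all_fingroup all_algebra.
From mathcomp Require Import reals.
From mathcomp Require Import ring lra.
From mathcomp Require Import complex.

Set Implicit Arguments.
Unset Strict Implicit.
Unset Printing Implicit Defensive.

Import Order.TTheory GRing.Theory Num.Theory.
Local Open Scope ring_scope.

(** * Positive definite matrices *)

Definition pos_def (R : realType) (n : nat) (B : 'M[R]_n) : Prop :=
  forall v : 'cV[R]_n, v != 0 -> 0 < (v^T *m B *m v) 0 0.

(** A nonzero kernel vector would make the quadratic form vanish. *)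
Lemma pos_def_unitmx (R : realType) (n : nat) (B : 'M[R]_n) :
  pos_def B -> B \in unitmx.
Proof.
move=> B_pos; rewrite -unitmx_tr -row_free_unit -kermx_eq0.
apply/eqP/row_matrixP => i; rewrite row0; apply/eqP/negPn/negP => ker_n0.
have := B_pos (row i (kermx B^T))^T; rewrite trmx_eq0 => /(_ ker_n0).
rewrite -mulmxA trmxK.
have -> : B *m (row i (kermx B^T))^T = 0.
  by apply: trmx_inj; rewrite trmx_mul trmxK -row_mul mulmx_ker row0 trmx0.
by rewrite mulmx0 mxE ltxx.
Qed.

Lemma pos_def_ge0 (R : realType) (n : nat) (B : 'M[R]_n) (v : 'cV[R]_n) :
  pos_def B -> 0 <= (v^T *m B *m v) 0 0.
Proof.
move=> B_pos; have [->|/B_pos/ltW//] := eqVneq v 0.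
by rewrite mulmx0 mxE.
Qed.

Lemma pos_def_congr (R : realType) (n k : nat) (B : 'M[R]_n)
    (K : 'M[R]_(n, k)) :
  pos_def B -> row_free K^T -> pos_def (K^T *m B *m K).
Proof.
move=> B_pos K_free v v_n0; have Kv_n0 : K *m v != 0.
  apply: contra v_n0 => /eqP/(congr1 trmx); rewrite trmx_mul trmx0 => Kv0.
  by rewrite -trmx_eq0 -(mulmx_free_eq0 _ K_free) Kv0.
by have := B_pos _ Kv_n0; rewrite trmx_mul !mulmxA.
Qed.

Lemma mul_tr_sqr (R : realType) (n : nat) (v : 'cV[R]_n) :
  (v^T *m v) 0 0 = \sum_(i < n) v i 0 ^+ 2.
Proof. by rewrite mxE; apply: eq_bigr => i _; rewrite mxE expr2. Qed.

Lemma pos_def1 (R : realType) (n : nat) : pos_def (1%:M : 'M[R]_n).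
Proof.
move=> v v_n0; rewrite mulmx1 mul_tr_sqr lt_def sumr_ge0 ?andbT; last first.
  by move=> i _; rewrite sqr_ge0.
apply: contra v_n0; rewrite psumr_eq0; last by move=> i _; rewrite sqr_ge0.
move=> /allP v0; apply/eqP/colP => i; rewrite mxE.
by apply/eqP; have := v0 i (mem_index_enum _); rewrite sqrf_eq0.
Qed.

(** * Simultaneous diagonalization of a symmetric-definite pencil *)

Lemma bilinear_sym (R : realType) (n : nat) (M : 'M[R]_n) (x y : 'cV[R]_n) :
  M^T = M -> (x^T *m M *m y) 0 0 = (y^T *m M *m x) 0 0.
Proof.
move=> M_sym; have <- : (x^T *m M *m y)^T = y^T *m M *m x.
  by rewrite !trmx_mul trmxK M_sym mulmxA.
by rewrite [RHS]mxE.
Qed.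

(* A complex eigenvector [x + i y] exists; comparing [x A y] with [y A x] shows
   that the imaginary part of its eigenvalue vanishes. *)
Lemma gen_eigenvector_exists (R : realType) (n : nat) (A B : 'M[R]_n.+1) :
  A^T = A -> B^T = B -> pos_def B ->
  exists (mu : R) (v : 'cV[R]_n.+1), gen_eigenvector A B mu v.
Proof.
move=> A_sym B_sym B_pos.
pose toC := @real_complex R.
have B_unit := pos_def_unitmx B_pos.
(* A left eigenvector [v] of [A *m invmx B] satisfies [v A = z v B], so it is already a left
   eigenvector of the pencil. *)
have [z /eigenvalueP[v v_eig v_n0]] :=
  eigenvalue_closed (map_mx toC (A *m invmx B)) (ltn0Sn n).
pose x : 'cV[R]_n.+1 := \col_i complex.Re (v 0 i).
pose y : 'cV[R]_n.+1 := \col_i complex.Im (v 0 i).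
pose al := complex.Re z; pose be := complex.Im z.
have v_pencil : v *m map_mx toC A = z *: (v *m map_mx toC B).
  by rewrite scalemxAl -v_eig map_mxM -!mulmxA -map_mxM mulVmx //
     map_mx1 mulmx1.
have mulC_re (M : 'M[R]_n.+1) i :
    complex.Re ((v *m map_mx toC M) 0 i) = (x^T *m M) 0 i.
  rewrite !mxE raddf_sum; apply: eq_bigr => j _; rewrite !mxE.
  by case: (v 0 j) => p q /=; rewrite mulr0 subr0.
have mulC_im (M : 'M[R]_n.+1) i :
    complex.Im ((v *m map_mx toC M) 0 i) = (y^T *m M) 0 i.
  rewrite !mxE raddf_sum; apply: eq_bigr => j _; rewrite !mxE.
  by case: (v 0 j) => p q /=; rewrite mulr0 add0r.
have ReM (p q : R[i]) :
    complex.Re (p * q) = complex.Re p * complex.Re q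
      - complex.Im p * complex.Im q.
  by case: p q => [? ?] [? ?].
have ImM (p q : R[i]) :
    complex.Im (p * q) = complex.Re p * complex.Im q
      + complex.Im p * complex.Re q.
  by case: p q => [? ?] [? ?].
have xA : x^T *m A = al *: (x^T *m B) - be *: (y^T *m B).
  apply/rowP => i; rewrite -mulC_re v_pencil [in LHS]mxE ReM mulC_re mulC_im.
  by rewrite -/al -/be !mxE.
have yA : y^T *m A = al *: (y^T *m B) + be *: (x^T *m B).
  apply/rowP => i; rewrite -mulC_im v_pencil [in LHS]mxE ImM mulC_re mulC_im.
  by rewrite -/al -/be !mxE.
have xA_y : (x^T *m A *m y) 0 0
    = al * (x^T *m B *m y) 0 0 - be * (y^T *m B *m y) 0 0.
  by rewrite xA mulmxBl -!scalemxAl [LHS]mxE [X in X + _]mxE [X in _ + X]mxE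
     [X in - X]mxE.
have yA_x : (y^T *m A *m x) 0 0
    = al * (y^T *m B *m x) 0 0 + be * (x^T *m B *m x) 0 0.
  by rewrite yA mulmxDl -!scalemxAl [LHS]mxE [X in X + _]mxE [X in _ + X]mxE.
have be0 : be * ((x^T *m B *m x) 0 0 + (y^T *m B *m y) 0 0) = 0.
  move: yA_x; rewrite (bilinear_sym y x A_sym) xA_y (bilinear_sym y x B_sym).
  by rewrite mulrDr; lra.
have xy_n0 : (x != 0) || (y != 0).
  apply/negPn; apply: contra v_n0; rewrite negb_or !negbK.
  move=> /andP[/eqP/colP x0 /eqP/colP y0]; apply/eqP/rowP => i.
  move: (x0 i) (y0 i); rewrite !mxE.
  by case: (v 0 i) => ? ? /= -> ->.
have {}be0 : be = 0.
  apply/eqP; move/eqP: be0; rewrite mulf_eq0 => /orP[//|].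
  have := pos_def_ge0 x B_pos; have := pos_def_ge0 y B_pos.
  by case/orP: xy_n0 => /B_pos; lra.
have eig (u : 'cV[R]_n.+1) :
    u^T *m A = al *: (u^T *m B) -> A *m u = al *: (B *m u).
  by move=> uA; apply: trmx_inj; rewrite linearZ /= !trmx_mul A_sym B_sym.
exists al; case/orP: xy_n0 => u_n0.
- by exists x; split=> //; apply: eig; rewrite xA be0 scale0r subr0.
- by exists y; split=> //; apply: eig; rewrite yA be0 scale0r addr0.
Qed.

(** Deflation: one eigenvector [v] is normalized to [v^T B v = 1], and the induction hypothesis is
    applied to the pencil compressed to the B-orthogonal complement of [v]. The cross terms in [A]
    vanish because [A v] is a multiple of [B v]. *)
Lemma pencil_diagonalization (R : realType) (n : nat) (A B : 'M[R]_n) :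
  A^T = A -> B^T = B -> pos_def B ->
  exists (mu : 'rV[R]_n) (V : 'M[R]_n),
    V^T *m B *m V = 1%:M /\ V^T *m A *m V = diag_mx mu.
Proof.
elim: n A B => [|n IHn] A B A_sym B_sym B_pos.
  by exists 0, 1%:M; split; apply/matrixP => -[].
have [mu [v0 [v0_n0 v0_eig]]] := gen_eigenvector_exists A_sym B_sym B_pos.
pose c := (v0^T *m B *m v0) 0 0.
have c_gt0 : 0 < c by apply: B_pos.
pose v := (Num.sqrt c)^-1 *: v0.
have vBv : v^T *m B *m v = 1%:M.
  rewrite /v [(_ *: v0)^T]linearZ /= -!scalemxAl -scalemxAr scalerA.
  rewrite -invfM -expr2 sqr_sqrtr ?ltW // [X in _ *: X]mx11_scalar -/c.
  by rewrite scale_scalar_mx mulVf ?gt_eqF.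
have v_eig : A *m v = mu *: (B *m v).
  by rewrite /v -!scalemxAr v0_eig !scalerA mulrC.
pose u := v^T *m B.
have rank_u : \rank u = 1%N.
  rewrite rank_rV; have [u0|//] := eqVneq u 0.
  move: vBv; rewrite -/u u0 mul0mx => /matrixP/(_ 0 0)/eqP.
  by rewrite !mxE eq_sym oner_eq0.
(* The rows of [K] form a basis of the B-orthogonal complement of [v]. The kernel basis has
   [\rank (kermx u^T)] rows; quantifying over [K] lets this number be rewritten to [n], the size
   that the induction hypothesis expects. *)
have [K [K_free Ku]] : exists K : 'M[R]_(n, n.+1), row_free K /\ u *m K^T = 0.
  have : exists K : 'M[R]_(\rank (kermx u^T), n.+1), row_free K /\ u *m K^T = 0.
    exists (row_base (kermx u^T)); split; first exact: row_base_free.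
    apply: trmx_inj; rewrite (trmx_mul u) trmxK trmx0.
    by apply/sub_kermxP; rewrite eq_row_base.
  by rewrite mxrank_ker mxrank_tr rank_u subn1.
have KuT : K *m B *m v = 0.
  by apply: trmx_inj; rewrite !trmx_mul B_sym mulmxA Ku trmx0.
have [|||mu' [V' [V'BV' V'AV']]] := IHn (K *m A *m K^T) (K *m B *m K^T).
- by rewrite !trmx_mul trmxK A_sym mulmxA.
- by rewrite !trmx_mul trmxK B_sym mulmxA.
- by have := pos_def_congr (K := K^T) B_pos; rewrite trmxK; apply.
pose P := K^T *m V'.
have PBP : P^T *m B *m P = 1%:M by rewrite -V'BV' /P trmx_mul trmxK !mulmxA.
have PAP : P^T *m A *m P = diag_mx mu'.
  by rewrite -V'AV' /P trmx_mul trmxK !mulmxA.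
have vBP : v^T *m B *m P = 0 by rewrite /P mulmxA Ku mul0mx.
have PBv : P^T *m B *m v = 0.
  by rewrite /P trmx_mul trmxK -!mulmxA [K *m _]mulmxA KuT mulmx0.
have vA : v^T *m A = mu *: (v^T *m B).
  by apply: trmx_inj; rewrite [RHS]linearZ /= !(trmx_mul v^T) trmxK A_sym B_sym.
pose W : 'M[R]_(n.+1, 1 + n) := row_mx v P.
pose nu : 'rV[R]_(1 + n) := row_mx (const_mx mu) mu'.
suff [WBW WAW] : W^T *m B *m W = 1%:M /\ W^T *m A *m W = diag_mx nu.
  by exists nu, W.
rewrite tr_row_mx !mul_col_mx !mul_mx_row; split.
  by rewrite vBv vBP PBv PBP -block_mxEv -scalar_mx_block.
rewrite vA -!scalemxAl vBv vBP -[P^T *m A *m v]mulmxA v_eig -scalemxAr mulmxA.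
rewrite PBv PAP !scaler0 -block_mxEv scale_scalar_mx mulr1.
by rewrite diag_mx_row diag_const_mx.
Qed.

(** Congruence by [V] turns the pencil into the diagonal matrix with entries ['X - mu_i]. It
    multiplies the determinant by [\det V ^+ 2], which is the inverse of [\det B]. *)
Lemma det_pencil (R : realType) (n : nat) (A B V : 'M[R]_n) (mu : 'rV[R]_n) :
  V^T *m B *m V = 1%:M -> V^T *m A *m V = diag_mx mu ->
  \det ('X *: map_mx polyC B - map_mx polyC A)
    = \det B *: \prod_(i < n) ('X - (mu 0 i)%:P).
Proof.
move=> VBV VAV.
have detV : \det V * \det B * \det V = 1.
  by have := congr1 determinant VBV; rewrite !det_mulmx det_tr det1.
pose Vp := map_mx polyC V.
have VpV : Vp^T *m ('X *: map_mx polyC B - map_mx polyC A) *m Vp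
    = diag_mx (\row_i ('X - (mu 0 i)%:P)).
  rewrite mulmxBr mulmxBl -scalemxAr -scalemxAl /Vp map_trmx -!map_mxM VBV VAV.
  apply/matrixP => i j; rewrite !mxE.
  by case: eqP => _; rewrite ?rmorph1 ?mulr1 //= !rmorph0 mulr0 subr0.
have := congr1 determinant VpV; rewrite !det_mulmx det_tr det_diag.
rewrite /Vp det_map_mx; under eq_bigr do rewrite mxE.
move=> <-; rewrite mulrAC -polyCM -mul_polyC mulrA -polyCM mulrA.
by rewrite [\det B * _]mulrC detV mul1r.
Qed.

Lemma gen_eigenvalues_exist (R : realType) (n : nat) (A B : 'M[R]_n) :
  A^T = A -> B^T = B -> pos_def B -> exists lam, gen_eigenvalues A B lam.
Proof.
move=> A_sym B_sym B_pos.
have [mu [V [VBV VAV]]] := pencil_diagonalization A_sym B_sym B_pos.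
pose s := sort >=%R [seq mu 0 i | i <- enum 'I_n].
have size_s : size s = n by rewrite size_sort size_map size_enum_ord.
(* Since [s] has size [n], the default value 0 of the lookup is never read. *)
exists (fun i => s`_i); split.
  rewrite (det_pencil VBV VAV); congr (_ *: _).
  rewrite -(big_mkord xpredT (fun i => 'X - (s`_i)%:P)) -[in RHS]size_s.
  rewrite -(big_nth 0 xpredT (fun x => 'X - x%:P)).
  by rewrite (perm_big _ (permEl (perm_sort _ _))) big_map big_enum.
move=> i j le_ij; apply: (sorted_leq_nth (leT := >=%R)) => //.
- by move=> x y z; apply: (rev_trans le_trans).
- exact: lexx.
- by apply: sort_sorted => x y; apply: le_total.
- by rewrite inE size_s.
- by rewrite inE size_s.
Qed.

Lemma congr_colsub (R : realType) (n k : nat) (M V : 'M[R]_n)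
    (f : 'I_k -> 'I_n) :
  (colsub f V)^T *m M *m colsub f V = mxsub f f (V^T *m M *m V).
Proof.
apply/matrixP => i j; rewrite !mxE; apply: eq_bigr => l _; rewrite !mxE.
by congr (_ * _); apply: eq_bigr => l' _; rewrite !mxE.
Qed.

(** Here [lam] is known only through the roots of a determinant. Unique factorization into monic
    linear factors makes it a permutation of the diagonal obtained above, and permuting the columns
    of [V] puts that diagonal in the prescribed order. *)
Lemma gen_eigenvalues_diag (R : realType) (n : nat) (A B : 'M[R]_n) lam :
  A^T = A -> B^T = B -> pos_def B -> gen_eigenvalues A B lam ->
  exists V : 'M[R]_n,
    V^T *m B *m V = 1%:M /\ V^T *m A *m V = diag_mx (\row_i lam i).
Proof.
move=> A_sym B_sym B_pos [det_lam lam_sorted].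
have [mu [V [VBV VAV]]] := pencil_diagonalization A_sym B_sym B_pos.
have det_B : \det B != 0 by rewrite -unitfE -unitmxE pos_def_unitmx.
have : perm_eq (codom lam) [tuple mu 0 i | i < n].
  apply: prod_XsubC_eq; rewrite codomE big_map big_enum /= big_map big_enum /=.
  by apply: (scalerI det_B); rewrite -det_lam -(det_pencil VBV VAV).
case/tuple_permP => p lam_p.
have {}lam_p i : lam i = mu 0 (p i).
  have := congr1 (fun s => nth 0 s i) lam_p.
  rewrite codomE (nth_map i) ?size_enum_ord // nth_ord_enum => ->.
  by rewrite (nth_map i) ?size_enum_ord // nth_ord_enum tnth_mktuple.
exists (colsub p V); rewrite !congr_colsub VBV VAV; split.
- by apply/matrixP => i j; rewrite !mxE (inj_eq perm_inj).
- apply/matrixP => i j; rewrite !mxE (inj_eq perm_inj).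
  by case: eqP => // ->; rewrite lam_p.
Qed.

(** * Frobenius norms as traces, and matrix least squares *)

Lemma mxtrace_mul_tr (R : realType) (p q : nat) (A : 'M[R]_(p, q)) :
  \tr (A *m A^T) = \sum_(i < p) \sum_(j < q) A i j ^+ 2.
Proof.
apply: eq_bigr => i _; rewrite mxE; apply: eq_bigr => j _.
by rewrite mxE expr2.
Qed.

Lemma mxtrace_mul_tr_ge0 (R : realType) (p q : nat) (A : 'M[R]_(p, q)) :
  0 <= \tr (A *m A^T).
Proof.
by rewrite mxtrace_mul_tr; do 2!apply: sumr_ge0 => ? _; apply: sqr_ge0.
Qed.

Lemma mxtrace_mul_tr_eq0 (R : realType) (p q : nat) (A : 'M[R]_(p, q)) :
  \tr (A *m A^T) = 0 -> A = 0.
Proof.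
have ge0 (i : 'I_p) : 0 <= \sum_(j < q) A i j ^+ 2.
  by apply: sumr_ge0 => j _; apply: sqr_ge0.
rewrite mxtrace_mul_tr => A0; apply/matrixP => i j; rewrite mxE; apply/eqP.
have := psumr_eq0P (fun i _ => ge0 i) A0 (i := i) isT.
move=> /psumr_eq0P - /(_ (fun j _ => sqr_ge0 _) j isT)/eqP.
by rewrite sqrf_eq0.
Qed.

Lemma frobenius_sqr (R : realType) (p q : nat) (A : 'M[R]_(p, q)) :
  frobenius A ^+ 2 = \tr (A *m A^T).
Proof.
rewrite mxtrace_mul_tr sqr_sqrtr //.
by rewrite -mxtrace_mul_tr mxtrace_mul_tr_ge0.
Qed.

Lemma euclid_sqr (R : realType) (n : nat) (v : 'cV[R]_n) :
  euclid v ^+ 2 = (v^T *m v) 0 0.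
Proof.
by rewrite mul_tr_sqr sqr_sqrtr // sumr_ge0 // => i _; rewrite sqr_ge0.
Qed.

Lemma gram_unitmx (R : realType) (n r : nat) (D : 'M[R]_(n, r)) :
  \rank D = r -> D^T *m D \in unitmx.
Proof.
move=> D_rank; rewrite -[D^T]mulmx1; apply/pos_def_unitmx/pos_def_congr.
  exact: pos_def1.
by rewrite /row_free mxrank_tr D_rank.
Qed.

Lemma pythagoras_mx (R : realType) (p q : nat) (X Y : 'M[R]_(p, q)) :
  X *m Y^T = 0 ->
  \tr ((X + Y) *m (X + Y)^T) = \tr (X *m X^T) + \tr (Y *m Y^T).
Proof.
move=> XY0; have YX0 : Y *m X^T = 0.
  by apply: trmx_inj; rewrite trmx_mul trmxK trmx0.
by rewrite linearD mulmxDl !mulmxDr /= XY0 YX0 addr0 add0r linearD.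
Qed.

(** The residual [G - a0 D^T] of the normal equations is orthogonal to every [e D^T], so Pythagoras
    applies to its sum with [(a + a0) D^T]. *)
Lemma least_squares_mx (R : realType) (k n r : nat) (G : 'M[R]_(k, n))
    (D : 'M[R]_(n, r)) (a : 'M[R]_(k, r)) :
  \rank D = r ->
  let N := D^T *m D in
  \tr ((G + a *m D^T) *m (G + a *m D^T)^T)
  = \tr (G *m G^T) - \tr (invmx N *m (D^T *m G^T *m G *m D))
    + \tr (((a + G *m D *m invmx N) *m D^T)
           *m ((a + G *m D *m invmx N) *m D^T)^T).
Proof.
move=> D_rank N; have N_unit : N \in unitmx := gram_unitmx D_rank.
have N_sym : N^T = N by rewrite trmx_mul trmxK.
pose a0 := G *m D *m invmx N.
have res_orth : (G - a0 *m D^T) *m D = 0.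
  by rewrite mulmxBl -mulmxA -/N mulmxKV // subrr.
have orth (e : 'M[R]_(k, r)) : (G - a0 *m D^T) *m (e *m D^T)^T = 0.
  by rewrite trmx_mul trmxK mulmxA res_orth mul0mx.
have -> : G + a *m D^T = G - a0 *m D^T + (a + a0) *m D^T.
  by rewrite mulmxDl addrA addrAC subrK.
rewrite (pythagoras_mx (orth _)); congr (_ + _).
(* A second use of Pythagoras, now on [G] itself, evaluates the squared norm of the residual. *)
have := pythagoras_mx (orth a0); rewrite subrK => ->.
have -> : \tr (a0 *m D^T *m (a0 *m D^T)^T)
    = \tr (invmx N *m (D^T *m G^T *m G *m D)).
  rewrite trmx_mul trmxK mulmxA -(mulmxA a0) -/N mulmxKV //.
  rewrite /a0 !trmx_mul trmx_inv N_sym -!mulmxA mulmxA mxtrace_mulC.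
  by rewrite !mulmxA.
by rewrite addrK.
Qed.

(** * The Ky Fan bound on the trace of a compression *)

(** A threshold [t] separates the first [r] values from the others. With [e] the indicator of the
    first [r] indices, [lam i - t] and [e i - q i] never have opposite signs. *)
Lemma sum_weights_le (R : realType) (m r : nat) (hr : (r <= m)%N)
    (lam q : 'I_m -> R) :
  (forall i j : 'I_m, (i <= j)%N -> lam j <= lam i) ->
  (forall i, 0 <= q i <= 1) -> \sum_(i < m) q i = r%:R ->
  \sum_(i < m) lam i * q i <= \sum_(i < r) lam (widen_ord hr i).
Proof.
move=> lam_sorted q_bnd q_sum; rewrite -(big_ord_narrow hr).
pose e (i : 'I_m) : R := (i < r)%:R.
have e_sum : \sum_(i < m) e i = r%:R.
  rewrite (eq_bigr (fun i : 'I_m => if (i < r)%N then 1 else 0)); last first.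
    by move=> i _; rewrite /e; case: ifP.
  by rewrite -big_mkcond (big_ord_narrow hr) sumr_const card_ord.
(* For [r = 0] the largest value serves as [t] (any number if [m = 0]); otherwise the last of the
   first [r] values, whose index is [r - 1]. *)
have [t t_sep] : exists t : R, forall i : 'I_m,
    ((i < r)%N -> t <= lam i) /\ ((r <= i)%N -> lam i <= t).
  case: (r) hr => [|r'] hr'.
    case: (m) lam lam_sorted => [|m'] l l_sorted; first by exists 0 => -[].
    by exists (l ord0) => i; split=> // _; apply: l_sorted.
  by exists (lam (Ordinal hr')) => i; split => [|/ltnW] h; apply: lam_sorted.
have -> : \sum_(i < m | (i < r)%N) lam i = \sum_(i < m) lam i * e i.
  rewrite big_mkcond; apply: eq_bigr => i _; rewrite /e.
  by case: ifP; rewrite ?mulr1 ?mulr0.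
rewrite -subr_ge0 -sumrB.
(* Subtracting [t] changes nothing, because [e] and [q] have the same sum. *)
have -> : \sum_(i < m) (lam i * e i - lam i * q i)
    = \sum_(i < m) (lam i - t) * (e i - q i).
  apply/eqP; rewrite -subr_eq0 -sumrB.
  rewrite (eq_bigr (fun i => t * (e i - q i))); last by move=> i _; ring.
  by rewrite -mulr_sumr sumrB e_sum q_sum subrr mulr0.
apply: sumr_ge0 => i _; have [/andP[q0 q1] [le_r ge_r]] := (q_bnd i, t_sep i).
rewrite /e; case: ltnP => [/le_r|/ge_r] h.
  by rewrite mulr_ge0 // subr_ge0.
by rewrite mulr_le0 // ?subr_le0.
Qed.

(** The trace is a weighted sum of the [lam i] whose weights are the diagonal entries of the
    orthogonal projector [Q]. Symmetry and idempotence make [Q i i] a sum of squares including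
    [Q i i ^+ 2], hence a number in [0, 1], and the trace of [Q] is [r]. *)
Lemma trace_compression_le (R : realType) (m r : nat) (hr : (r <= m)%N)
    (lam : 'I_m -> R) (c : 'M[R]_(m, r)) :
  (forall i j : 'I_m, (i <= j)%N -> lam j <= lam i) -> \rank c = r ->
  \tr (invmx (c^T *m c) *m (c^T *m diag_mx (\row_i lam i) *m c))
    <= \sum_(i < r) lam (widen_ord hr i).
Proof.
move=> lam_sorted c_rank; set N := c^T *m c.
have N_unit : N \in unitmx := gram_unitmx c_rank.
have N_sym : N^T = N by rewrite trmx_mul trmxK.
pose Q := c *m invmx N *m c^T.
have Q_sym : Q^T = Q by rewrite !trmx_mul trmxK trmx_inv N_sym mulmxA.
have Q_idem : Q *m Q = Q.
  rewrite /Q -!mulmxA; congr (_ *m _).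
  by rewrite [c^T *m (_ *m _)]mulmxA -/N mulKVmx.
have Qii i : Q i i = \sum_j Q i j ^+ 2.
  rewrite -[in LHS]Q_idem mxE; apply: eq_bigr => j _.
  have := congr1 (fun M : 'M_m => M i j) Q_sym; rewrite [LHS]mxE => ->.
  by rewrite expr2.
have Qii_ge i : Q i i ^+ 2 <= Q i i.
  by rewrite {2}Qii (bigD1 i) //= lerDl sumr_ge0 // => j _; rewrite sqr_ge0.
have -> : \tr (invmx N *m (c^T *m diag_mx (\row_i lam i) *m c))
    = \sum_(i < m) lam i * Q i i.
  rewrite !mulmxA mxtrace_mulC !mulmxA -/Q.
  by apply: eq_bigr => i _; rewrite mul_mx_diag !mxE mulrC.
apply: sum_weights_le => // [i|].
  by have := Qii_ge i; nra.
by rewrite -[LHS]/(\tr Q) /Q mxtrace_mulC mulmxA mulmxV // mxtrace1.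
Qed.

(** * Small perturbations to full rank *)

(** The [size q] distinct candidates [e / i.+1] outnumber the possible roots of [q]. *)
Lemma nonroot_arbitrarily_small (R : realType) (q : {poly R}) (e : R) :
  q != 0 -> 0 < e -> exists2 t, 0 < t <= e & ~~ root q t.
Proof.
move=> q_n0 e_gt0; pose s := [seq e / i.+1%:R | i <- iota 0 (size q)].
have /allPn[t /mapP[i _ ->] t_nroot] : ~~ all (root q) s.
  apply/negP => s_roots; have := max_poly_roots q_n0 s_roots.
  rewrite size_map size_iota ltnn map_inj_uniq ?iota_uniq => [/(_ isT)//|].
  move=> i j /(mulfI (lt0r_neq0 e_gt0))/invr_inj/eqP.
  by rewrite eqr_nat eqSS => /eqP.
exists (e / i.+1%:R) => //.
by rewrite divr_gt0 ?ltr0Sn //= ler_pdivrMr ?ltr0Sn // ler_peMr ?ler1n ?ltW.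
Qed.

(* [det (J^T (a + t J))], with [J = pid_mx r], is a characteristic polynomial
   in [t]; it has finitely many roots. *)
Lemma full_rank_perturbation (R : realType) (k r : nat) (a : 'M[R]_(k, r)) e :
  (r <= k)%N -> 0 < e ->
  exists2 t, 0 < t <= e & \rank (a + t *: pid_mx r)%R = r.
Proof.
move=> le_rk e_gt0; pose J : 'M[R]_(k, r) := pid_mx r.
have JJ : J^T *m J = 1%:M.
  by rewrite tr_pid_mx mul_pid_mx minnn (minn_idPr le_rk) pid_mx_1.
have q_n0 := monic_neq0 (char_poly_monic (- (J^T *m a))).
have [t t_bnd t_nroot] := nonroot_arbitrarily_small q_n0 e_gt0.
exists t => //; apply/eqP; rewrite eqn_leq rank_leq_col.
(* Since [t] is not an eigenvalue of [- J^T a], the matrix [- J^T (a + t J)] has rank [r], which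
   bounds the rank of [a + t J] from below. *)
move: t_nroot; rewrite -eigenvalue_root_char negbK kermx_eq0 => /eqP {1}<-.
have -> : - (J^T *m a) - t%:M = - J^T *m (a + t *: J).
  by rewrite mulmxDr -scalemxAr !mulNmx JJ scalerN scale_scalar_mx mulr1.
exact: mxrankM_maxr.
Qed.

(** * The objective for a fixed right factor, and its infimum *)

(** The least-squares left factor for a given [b]. The inverse Gram matrix accommodates columns of
    [b] that are not B-orthogonal, as competitors may have. *)
Definition best_left (R : realType) (ms m w r : nat) (G : 'M[R]_(ms, w))
    (C : 'M[R]_(m, w)) (b : 'M[R]_(m, r)) : 'M[R]_(ms, r) :=
  - (G *m C^T *m b *m invmx (b^T *m (C *m C^T) *m b)).

(** A generalized Rayleigh trace of the pencil on the range of [b]: the amount by which the optimal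
    left factor lowers the squared norm of [G]. *)
Definition reduction (R : realType) (ms m w r : nat) (G : 'M[R]_(ms, w))
    (C : 'M[R]_(m, w)) (b : 'M[R]_(m, r)) : R :=
  \tr (invmx (b^T *m (C *m C^T) *m b)
       *m (b^T *m (C *m G^T *m G *m C^T) *m b)).

Lemma rank_tr_mulmx (R : realType) (m w r : nat) (C : 'M[R]_(m, w))
    (b : 'M[R]_(m, r)) :
  \rank C = m -> \rank b = r -> \rank (C^T *m b) = r.
Proof.
move=> C_rank b_rank; rewrite -mxrank_tr trmx_mul trmxK.
by rewrite mxrankMfree ?mxrank_tr // /row_free C_rank.
Qed.

Lemma objective_split (R : realType) (ms m w r : nat) (G : 'M[R]_(ms, w))
    (C : 'M[R]_(m, w)) (a : 'M[R]_(ms, r)) (b : 'M[R]_(m, r)) :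
  \rank C = m -> \rank b = r ->
  objective G C (a, b) = \tr (G *m G^T) - reduction G C b
    + \tr (((a - best_left G C b) *m (b^T *m C))
           *m ((a - best_left G C b) *m (b^T *m C))^T).
Proof.
move=> C_rank b_rank; have D_rank := rank_tr_mulmx C_rank b_rank.
have := least_squares_mx G a D_rank.
rewrite /objective /= frobenius_sqr trmx_mul trmxK -[a *m b^T *m C]mulmxA => ->.
by rewrite /reduction /best_left opprK !mulmxA.
Qed.

Lemma objective_best_left (R : realType) (ms m w r : nat) (G : 'M[R]_(ms, w))
    (C : 'M[R]_(m, w)) (b : 'M[R]_(m, r)) :
  \rank C = m -> \rank b = r ->
  objective G C (best_left G C b, b) = \tr (G *m G^T) - reduction G C b.
Proof.
by move=> *; rewrite objective_split // subrr !mul0mx mxtrace0 addr0.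
Qed.

Lemma objective_ge (R : realType) (ms m w r : nat) (G : 'M[R]_(ms, w))
    (C : 'M[R]_(m, w)) (a : 'M[R]_(ms, r)) (b : 'M[R]_(m, r)) :
  \rank C = m -> \rank b = r ->
  \tr (G *m G^T) - reduction G C b <= objective G C (a, b).
Proof.
by move=> *; rewrite objective_split // lerDl mxtrace_mul_tr_ge0.
Qed.

(* [best_left G C b] may be rank deficient, so that it need not be a
   competitor; full-rank matrices arbitrarily close to it are. *)
Lemma solution_objective_le (R : realType) (ms m w r : nat)
    (G : 'M[R]_(ms, w)) (C : 'M[R]_(m, w)) (x : 'M[R]_(ms, r) * 'M[R]_(m, r))
    (b : 'M[R]_(m, r)) :
  \rank C = m -> \rank b = r -> (r <= ms)%N -> is_solution G C x ->
  objective G C x <= \tr (G *m G^T) - reduction G C b.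
Proof.
move=> C_rank b_rank le_r_ms [_ x_min].
pose J : 'M[R]_(ms, r) := pid_mx r.
pose K := \tr ((J *m (b^T *m C)) *m (J *m (b^T *m C))^T).
have K_ge0 : 0 <= K by apply: mxtrace_mul_tr_ge0.
rewrite leNgt; apply/negP; set q := _ - _; rewrite -subr_gt0.
set gap := _ - q => gap_gt0.
(* Perturbing by [t J] costs [t ^+ 2 * K]. The bound [t * (gap + K + 1) <= gap] gives [t < 1] and
   [t * K < gap], so the cost stays below [gap], against minimality of [x]. *)
have e_gt0 : 0 < gap / (gap + K + 1) by apply: divr_gt0; lra.
have [t /andP[t_gt0 t_le] t_rank] :=
  full_rank_perturbation (best_left G C b) le_r_ms e_gt0.
have := x_min (best_left G C b + t *: J, b) (conj t_rank b_rank).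
rewrite objective_split // -/q [_ + t *: J]addrC addrK -scalemxAl.
rewrite [(_ *: _)^T]linearZ /= -scalemxAl -scalemxAr !mxtraceZ -/K.
move: t_le; rewrite ler_pdivlMr; last by lra.
rewrite -[objective G C x](subrK q) -/gap => t_le.
by nra.
Qed.

(** The infimum over left factors for the solution's own [b] leaves no room for the square in
    [objective_split]; full row rank of [b^T C] then cancels that factor. *)
Lemma solution_left (R : realType) (ms m w r : nat)
    (G : 'M[R]_(ms, w)) (C : 'M[R]_(m, w)) (x : 'M[R]_(ms, r) * 'M[R]_(m, r)) :
  \rank C = m -> (r <= ms)%N -> is_solution G C x ->
  x.1 = best_left G C x.2.
Proof.
case: x => a b /= C_rank le_r_ms x_sol; have [[_ /= b_rank] _] := x_sol.
have := solution_objective_le C_rank b_rank le_r_ms x_sol.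
rewrite objective_split // gerDl => Y_le0; apply/eqP; rewrite -subr_eq0.
have free : row_free (b^T *m C).
  by rewrite /row_free -mxrank_tr trmx_mul trmxK rank_tr_mulmx.
rewrite -(mulmx_free_eq0 _ free); apply/eqP/mxtrace_mul_tr_eq0/eqP.
by rewrite eq_le Y_le0 mxtrace_mul_tr_ge0.
Qed.

(** In the coordinates [b = V c] the pencil becomes [(diag lam, 1)], and the Ky Fan bound applies to
    [c]. *)
Lemma reduction_le (R : realType) (ms m w r : nat) (hr : (r <= m)%N)
    (G : 'M[R]_(ms, w)) (C : 'M[R]_(m, w)) (lam : 'I_m -> R)
    (V : 'M[R]_m) (b : 'M[R]_(m, r)) :
  (forall i j : 'I_m, (i <= j)%N -> lam j <= lam i) ->
  V^T *m (C *m C^T) *m V = 1%:M ->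
  V^T *m (C *m G^T *m G *m C^T) *m V = diag_mx (\row_i lam i) ->
  \rank b = r ->
  reduction G C b <= \sum_(i < r) lam (widen_ord hr i).
Proof.
move=> lam_sorted VBV VAV b_rank.
have [_ V_unit] := mulmx1_unit VBV.
pose c := invmx V *m b; have bE : b = V *m c by rewrite mulKVmx.
have c_rank : \rank c = r.
  rewrite -mxrank_tr trmx_mul mxrankMfree ?mxrank_tr //.
  by rewrite row_free_unit unitmx_tr unitmx_inv.
apply: le_trans (trace_compression_le hr lam_sorted c_rank).
rewrite /reduction -VAV -[X in invmx (X *m c)]mulmx1 -VBV bE trmx_mul.
by rewrite !mulmxA.
Qed.

(** * Matrices of leading eigenvectors *)

Lemma col_mulmx (R : pzRingType) (m n p : nat) (A : 'M[R]_(m, n))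
    (B : 'M[R]_(n, p)) j :
  col j (A *m B) = A *m col j B.
Proof. by rewrite !colE mulmxA. Qed.

Lemma congr_mxE (R : pzRingType) (n k : nat) (M : 'M[R]_n)
    (b : 'M[R]_(n, k)) i j :
  (b^T *m M *m b) i j = ((col i b)^T *m M *m col j b) 0 0.
Proof.
rewrite tr_col -row_mul !mxE; apply: eq_bigr => l _.
by rewrite [row _ _ _ _]mxE [col _ _ _ _]mxE.
Qed.

Lemma top_eigenvectors_exist (R : realType) (m r : nat) (hr : (r <= m)%N)
    (A B : 'M[R]_m) :
  A^T = A -> B^T = B -> pos_def B ->
  exists lam b, top_eigenvectors hr A B lam b.
Proof.
move=> A_sym B_sym B_pos.
have [lam lam_eig] := gen_eigenvalues_exist A_sym B_sym B_pos.
have [V [VBV VAV]] := gen_eigenvalues_diag A_sym B_sym B_pos lam_eig.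
have V_unit : V \in unitmx by have [] := mulmx1_unit VBV.
(* Both sides agree after multiplication by the invertible [V^T]. *)
have AV : A *m V = B *m V *m diag_mx (\row_i lam i).
  have VT_unit : V^T \in unitmx by rewrite unitmx_tr.
  apply: (can_inj (mulKmx VT_unit)).
  by rewrite mulmxA VAV 2!mulmxA VBV mul1mx.
pose b := colsub (widen_ord hr) V; exists lam, b.
have bBb : b^T *m B *m b = 1%:M.
  by rewrite congr_colsub VBV; apply/matrixP => i j; rewrite !mxE.
split=> // [i|i j ne_ij _]; last first.
  by rewrite [LHS]mx11_scalar -congr_mxE bBb mxE (negPf ne_ij) raddf0.
split.
  apply/eqP => b0; have := congr_mxE B b i i.
  by rewrite bBb b0 mulmx0 !mxE eqxx => /eqP; rewrite oner_eq0.
have -> : col i b = col (widen_ord hr i) V by apply/colP => k; rewrite !mxE.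
by rewrite -!col_mulmx AV; apply/colP => k; rewrite mul_mx_diag !mxE mulrC.
Qed.

(** For distinct eigenvalues, evaluating [b_i^T A b_j] from either side gives [lam_i] and [lam_j]
    times the same B-product, which must vanish. For equal eigenvalues orthogonality is part of
    [top_eigenvectors]. *)
Lemma gram_top_eigenvectors (R : realType) (m r : nat) (hr : (r <= m)%N)
    (A B : 'M[R]_m) lam (b : 'M[R]_(m, r)) :
  A^T = A -> B^T = B -> pos_def B -> top_eigenvectors hr A B lam b ->
  exists2 n : 'rV[R]_r, b^T *m B *m b = diag_mx n & forall i, 0 < n 0 i.
Proof.
move=> A_sym B_sym B_pos [_ b_eig b_orth].
pose g i j := ((col i b)^T *m B *m col j b) 0 0.
exists (\row_i g i i) => [|i]; last first.
  by rewrite mxE; apply: B_pos; case: (b_eig i).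
apply/matrixP => i j; rewrite congr_mxE -/(g i j) !mxE.
case: eqVneq => [->//|ne_ij].
have [eq_lam|ne_lam] := eqVneq (lam (widen_ord hr i)) (lam (widen_ord hr j)).
  by rewrite /g (b_orth _ _ ne_ij eq_lam) mxE.
have [_ eig_i] := b_eig i; have [_ eig_j] := b_eig j.
have := bilinear_sym (col i b) (col j b) A_sym.
rewrite -!mulmxA eig_i eig_j -!scalemxAr !mulmxA [LHS]mxE [RHS]mxE.
rewrite -(bilinear_sym (col i b) (col j b) B_sym) -/(g i j) => /eqP.
rewrite -subr_eq0 -mulrBl mulf_eq0 subr_eq0 eq_sym (negPf ne_lam) /= => /eqP ->.
by rewrite mulr0n.
Qed.

Lemma mul_top_eigenvectors (R : realType) (m r : nat) (hr : (r <= m)%N)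
    (A B : 'M[R]_m) lam (b : 'M[R]_(m, r)) :
  top_eigenvectors hr A B lam b ->
  A *m b = B *m b *m diag_mx (\row_i lam (widen_ord hr i)).
Proof.
case=> _ b_eig _; apply/matrixP => k i.
have [_ /colP/(_ k)] := b_eig i.
by rewrite -!col_mulmx mul_mx_diag !mxE mulrC.
Qed.

Lemma diag_mx_unit (F : fieldType) (n : nat) (d : 'rV[F]_n) :
  (forall i, d 0 i != 0) -> diag_mx d \in unitmx.
Proof.
by move=> d_n0; rewrite unitmxE det_diag unitfE; apply/prodf_neq0 => i _.
Qed.

(** With a diagonal Gram matrix, its inverse scales column [i] by the reciprocal of the squared norm
    of [C^T b_i]. *)
Lemma left_factorE (R : realType) (ms m w r : nat) (G : 'M[R]_(ms, w))
    (C : 'M[R]_(m, w)) (b : 'M[R]_(m, r)) (n : 'rV[R]_r) :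
  b^T *m (C *m C^T) *m b = diag_mx n -> (forall i, 0 < n 0 i) ->
  left_factor G C b = best_left G C b.
Proof.
move=> bBb n_gt0; rewrite /best_left bBb.
have n_unit : diag_mx n \in unitmx.
  by apply: diag_mx_unit => i; rewrite gt_eqF.
rewrite -mulNmx; apply: (can_inj (mulmxK n_unit)); rewrite mulmxKV //.
apply/matrixP => k i; rewrite mul_mx_diag.
have euclidE : euclid (C^T *m col i b) ^+ 2 = n 0 i.
  have := congr1 (fun M : 'M_r => M i i) bBb.
  rewrite congr_mxE [RHS]mxE eqxx mulr1n => <-.
  by rewrite euclid_sqr trmx_mul trmxK !mulmxA.
rewrite mxE [left_factor _ _ _ _ _]mxE [X in X * _]mxE euclidE -col_mulmx !mxE.
by rewrite mulrAC div1r mulNr mulVf ?gt_eqF // mulN1r.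
Qed.

(** A zero on the diagonal of a Gram matrix means a zero column, so at most the first [i0] columns
    of [M] are nonzero. *)
Lemma rank_sampled_le (R : realType) (m k : nat) (M : 'M[R]_(k, m))
    (lam : 'I_m -> R) (i0 : 'I_m) :
  M^T *m M = diag_mx (\row_i lam i) ->
  (forall j : 'I_m, (i0 <= j)%N -> lam j = 0) -> (\rank M <= i0)%N.
Proof.
move=> MM lam0; have M0 i (j : 'I_m) : (i0 <= j)%N -> M i j = 0.
  move=> /lam0 lam_j0; have := congr1 (fun N : 'M_m => N j j) MM.
  rewrite !mxE eqxx lam_j0 => /psumr_eq0P.
  have ge0 l : true -> 0 <= M^T j l * M l j by rewrite mxE -expr2 sqr_ge0.
  by move=> /(_ ge0 i isT)/eqP; rewrite mxE mulf_eq0 orbb => /eqP.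
have <- : M *m pid_mx i0 = M.
  apply/matrixP => i j; rewrite mxE (bigD1 j) //= big1 => [|l /negPf ne_lj].
    rewrite addr0 mxE eqxx /=; case: ltnP => [_|/M0 ->]; first exact: mulr1.
    by rewrite mul0r.
  by rewrite mxE -[(l == j :> nat)]/(l == j) ne_lj mulr0.
apply: leq_trans (mxrankM_maxr _ _) _.
by rewrite rank_pid_mx // ltnW.
Qed.

(** * Optimal value and existence of solutions *)

Lemma low_rank_update (R : realType) (ms m w r : nat) (r_le_m : (r <= m)%N)
    (G : 'M[R]_(ms, w)) (C : 'M[R]_(m, w)) :
  let A : 'M[R]_m := C *m G^T *m G *m C^T in
  let B : 'M[R]_m := C *m C^T in
  (r <= ms)%N -> \rank C = m ->
  (exists (lam : 'I_m -> R) (b : 'M[R]_(m, r)),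
     top_eigenvectors r_le_m A B lam b)
  /\
  forall (lam : 'I_m -> R) (b : 'M[R]_(m, r)),
    top_eigenvectors r_le_m A B lam b ->
    let a : 'M[R]_(ms, r) := left_factor G C b in
    let value : R :=
      frobenius G ^+ 2 - \sum_(i < r) lam (widen_ord r_le_m i) in
    [/\ forall i : 'I_r, 0 <= lam (widen_ord r_le_m i),
        (exists x : 'M[R]_(ms, r) * 'M[R]_(m, r), is_solution G C x) <->
          (forall i : 'I_r, 0 < lam (widen_ord r_le_m i)),
        (exists x : 'M[R]_(ms, r) * 'M[R]_(m, r), is_solution G C x) ->
          is_solution G C (a, b),
        objective G C (a, b) = value /\
          (forall x : 'M[R]_(ms, r) * 'M[R]_(m, r),
             full_rank_pair x -> objective G C (a, b) <= objective G C x) &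
        forall x : 'M[R]_(ms, r) * 'M[R]_(m, r),
          is_solution G C x -> objective G C x = value].
Proof.
move=> A B le_r_ms C_rank.
have B_sym : B^T = B by rewrite trmx_mul trmxK.
have A_sym : A^T = A by rewrite !trmx_mul !trmxK !mulmxA.
have B_pos : pos_def B.
  rewrite /B -[C in C *m _]trmxK -[X in X *m _]mulmx1.
  apply: pos_def_congr; first exact: pos_def1.
  by rewrite trmxK /row_free C_rank.
split; first exact: top_eigenvectors_exist.
move=> lam b b_top a value.
have [[det_lam lam_sorted] _ _] := b_top.
have [V [VBV VAV]] :=
  gen_eigenvalues_diag A_sym B_sym B_pos (conj det_lam lam_sorted).
have [n bBb n_gt0] := gram_top_eigenvectors A_sym B_sym B_pos b_top.
have aE : a = best_left G C b := left_factorE G bBb n_gt0.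
set L := diag_mx (\row_i lam (widen_ord r_le_m i)).
(* On eigenvectors the Gram matrix factors out, so the Rayleigh trace reduces to the trace of
   [L]. *)
have bAb : b^T *m A *m b = b^T *m B *m b *m L.
  by rewrite -[LHS]mulmxA (mul_top_eigenvectors b_top) !mulmxA.
have N_unit : b^T *m B *m b \in unitmx.
  by rewrite bBb; apply: diag_mx_unit => i; rewrite gt_eqF.
have b_rank : \rank b = r.
  apply/eqP; rewrite eqn_leq rank_leq_col /=.
  by rewrite -{1}(mxrank_unit N_unit) mxrankM_maxr.
have red_b : reduction G C b = \sum_(i < r) lam (widen_ord r_le_m i).
  rewrite /reduction -/A -/B bAb mulKmx // mxtrace_diag.
  by apply: eq_bigr => i _; rewrite mxE.
have valueE : value = \tr (G *m G^T) - reduction G C b.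
  by rewrite /value frobenius_sqr red_b.
have obj_ab : objective G C (a, b) = value.
  by rewrite aE objective_best_left // valueE.
have value_le (x : 'M_(ms, r) * 'M_(m, r)) :
    full_rank_pair x -> value <= objective G C x.
  case: x => x1 x2 [_ /= x2_rank].
  apply: le_trans (objective_ge G x1 C_rank x2_rank).
  by rewrite valueE red_b lerD2l lerN2 (reduction_le r_le_m lam_sorted VBV VAV).
(* Each [lam i] is the squared norm of a column of [G C^T V]. This yields nonnegativity and ties
   vanishing eigenvalues to the rank of [G C^T]. *)
have GV_gram : (G *m C^T *m V)^T *m (G *m C^T *m V) = diag_mx (\row_i lam i).
  by rewrite -VAV !trmx_mul trmxK !mulmxA.
have lam_ge0 i : 0 <= lam i.
  have := congr1 (fun N : 'M_m => N i i) GV_gram.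
  rewrite [RHS]mxE eqxx mulr1n [RHS]mxE mxE => <-.
  by apply: sumr_ge0 => j _; rewrite [_^T _ _]mxE -expr2 sqr_ge0.
have sol_pos (x : 'M_(ms, r) * 'M_(m, r)) :
    is_solution G C x -> forall i : 'I_r, 0 < lam (widen_ord r_le_m i).
  move=> x_sol i; rewrite lt_def lam_ge0 andbT; apply/negP => /eqP lam_i0.
  have lam0 (j : 'I_m) : (i <= j)%N -> lam j = 0.
    move=> le_ij; apply/eqP; rewrite eq_le lam_ge0 andbT -lam_i0.
    exact: lam_sorted.
  (* Indices start at 0: if [lam_i] vanishes, only [i] eigenvalues precede it, so [G C^T] has rank
     at most [i < r]. But the left factor of a solution has rank [r] and factors through [G C^T]. *)
  have := rank_sampled_le (i0 := widen_ord r_le_m i) GV_gram lam0.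
  apply/negP; rewrite -ltnNge /=.
  have [[x1_rank _] _] := x_sol.
  apply: leq_trans (ltn_ord i) _; rewrite -{1}x1_rank.
  rewrite (solution_left C_rank le_r_ms x_sol) /best_left.
  have V_free : row_free V by rewrite row_free_unit; case: (mulmx1_unit VBV).
  rewrite mxrank_opp (mxrankMfree _ V_free).
  by rewrite -[X in (\rank X <= _)%N]mulmxA mxrankM_maxl.
have sol_ab : (forall i : 'I_r, 0 < lam (widen_ord r_le_m i)) ->
    is_solution G C (a, b).
  move=> lam_pos; split; last by move=> y /value_le; rewrite obj_ab.
  split=> //=; apply/eqP; rewrite eqn_leq rank_leq_col /=.
  have L_unit : L \in unitmx.
    by apply: diag_mx_unit => i; rewrite mxE gt_eqF.
  (* Exhibiting the invertible [L] as a product with [- a^T] forces [a] to have rank [r]. *)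
  have aTGCb : - a^T *m (G *m C^T *m b) = L.
    have N_sym : (b^T *m B *m b)^T = b^T *m B *m b by rewrite bBb tr_diag_mx.
    rewrite aE /best_left linearN /= opprK trmx_mul trmx_inv -/B N_sym.
    by rewrite -(mulKmx N_unit L) -bAb /A !trmx_mul !trmxK !mulmxA.
  rewrite -{1}(mxrank_unit L_unit) -aTGCb -(mxrank_tr a) -(mxrank_opp a^T).
  exact: mxrankM_maxl.
split=> //.
- split=> [[x]|lam_pos]; first exact: sol_pos.
  by exists (a, b); apply: sol_ab.
- by case=> x /sol_pos/sol_ab.
- by split=> // x /value_le; rewrite obj_ab.
- move=> x x_sol; apply/le_anti/andP.
  split; last by apply: value_le; case: x_sol.
  by rewrite valueE solution_objective_le.
Qed.

Theorem theorem4p1 (R : realType) (d w m ms r : nat)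
    (F : 'M[R]_(d, w)) (U : 'M[R]_(d, m))
    (p : 'I_m -> 'I_d) (s : 'I_ms -> 'I_d)
    (p_inj : injective p) (s_inj : injective s)
    (m_le_ms : (m <= ms)%N) (ms_lt_d : (ms < d)%N) (r_le_m : (r <= m)%N) :
  let P : 'M[R]_(d, m) := unit_columns R p in
  let S : 'M[R]_(d, ms) := unit_columns R s in
  let C : 'M[R]_(m, w) := deim_coef U P F in
  let G : 'M[R]_(ms, w) := S^T *m deim_residual U P F in
  let A : 'M[R]_m := C *m G^T *m G *m C^T in
  let B : 'M[R]_m := C *m C^T in
  P^T *m U \in unitmx ->
  \rank C = m ->
  (exists (lam : 'I_m -> R) (b : 'M[R]_(m, r)),
     top_eigenvectors r_le_m A B lam b)
  /\
  forall (lam : 'I_m -> R) (b : 'M[R]_(m, r)),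
    top_eigenvectors r_le_m A B lam b ->
    let a : 'M[R]_(ms, r) := left_factor G C b in
    let value : R :=
      frobenius G ^+ 2 - \sum_(i < r) lam (widen_ord r_le_m i) in
    [/\ forall i : 'I_r, 0 <= lam (widen_ord r_le_m i),
        (exists x : 'M[R]_(ms, r) * 'M[R]_(m, r), is_solution G C x) <->
          (forall i : 'I_r, 0 < lam (widen_ord r_le_m i)),
        (exists x : 'M[R]_(ms, r) * 'M[R]_(m, r), is_solution G C x) ->
          is_solution G C (a, b),
        objective G C (a, b) = value /\
          (forall x : 'M[R]_(ms, r) * 'M[R]_(m, r),
             full_rank_pair x -> objective G C (a, b) <= objective G C x) &
        forall x : 'M[R]_(ms, r) * 'M[R]_(m, r),
          is_solution G C x -> objective G C x = value].
Proof.
move=> P S C G A B _ C_rank.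
exact: low_rank_update (leq_trans r_le_m m_le_ms) C_rank.
Qed.
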